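(* Let $X$ be an Alexandrov space. Then $X$ is finite dimensional (i.e. its Krull dimension is a finite number) if and only if $X$ is of finite height (i.e. its height is a finite number). In this case, the Krull dimension of $X$ and the height of $X$ coincide, and this common number equals both the height and the Krull dimension of the Kolmogorov quotient $X_0$ of $X$.
   Context: A topological space is called Alexandrov if the union of an arbitrary family of closed subsets is closed (equivalently, the intersection of an arbitrary family of open subsets is open). $\operatorname{cl}\{x\}$ denotes the closure of the one-point set $\{x\}$. A topological space $Y$ is irreducible if it is not the union of two proper, non-empty, closed subsets, i.e. for closed subsets $B, C$ of $Y$, $Y = B\cup C$ implies $Y=B$ or $Y=C$. A subset of a topological space is irreducible if it is irreducible in the subspace topology. The Krull dimension of a topological space $X$ is the supremum of all lengths $n$ of chains $X_0\subset X_1\subset\dots\subset X_n$ with proper inclusions of non-empty closed irreducible subsets of $X$ (here the $X_i$ denote the members of the chain). The Krull dimension of the empty space is defined as $-1$. A space is called finite dimensional if its Krull dimension is a finite number. The height of an Alexandrov space $X$ is the supremum of all lengths $n$ of chains $\operatorname{cl}\{x_0\}\subset\dots\subset\operatorname{cl}\{x_n\}$ with proper inclusions, where $x_0,\dots,x_n\in X$. The height of the empty space is taken to be $-1$. An Alexandrov space is of finite height if its height is a finite number. The specialisation preorder on $X$ is given by $x\le y :\Leftrightarrow x\in\operatorname{cl}\{y\}$. The Kolmogorov quotient $X_0 := X/{\sim}$ is the quotient space (with the quotient topology) by the equivalence relation $x\sim y :\Leftrightarrow x\le y \text{ and } y\le x$; it is again an Alexandrov space. *)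

(* Defs.v *)
From HB Require Import structures.
From mathcomp Require Import all_boot all_order all_algebra.
From mathcomp Require Import all_classical all_reals.
From mathcomp Require Import ereal topology.

Set Implicit Arguments.
Unset Strict Implicit.
Unset Printing Implicit Defensive.

Import Order.TTheory GRing.Theory Num.Theory.

Local Open Scope classical_set_scope.
Local Open Scope ring_scope.
Local Open Scope quotient_scope.

Definition alexandrov (X : topologicalType) : Prop :=
  forall F : set (set X),
    (forall A, F A -> closed A) -> closed (\bigcup_(A in F) A).

(* The empty space is irreducible in this sense, so [krull_dim] has to require
   the members of a chain to be non-empty. *)
Definition irreducible_space (Y : topologicalType) : Prop :=
  forall B C : set Y, closed B -> closed C ->
    [set: Y] = B `|` C -> [set: Y] = B \/ [set: Y] = C.

(* [set_type A] is the type of points of [A] with the topology induced by the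
   inclusion; the library's [subspace A] is instead the whole of [X], with
   every point outside [A] isolated, and would not do here. *)
Definition irreducible_set (X : topologicalType) (A : set X) : Prop :=
  irreducible_space (set_type A).

(* Dimension and height take the values -1, 0, 1, ... and +oo; they live in
   [\bar R] only because this is where the library has suprema. *)
Definition krull_dim (R : realType) (X : topologicalType) : \bar R :=
  if [set: X] == set0 then (-1)%:E else
  ereal_sup [set n%:R%:E | n in [set n : nat |
    exists C : 'I_n.+1 -> set X,
      (forall i, [/\ closed (C i), irreducible_set (C i) & C i !=set0]) /\
      (forall i j : 'I_n.+1, (i < j)%N -> C i `<` C j)]].

Definition height (R : realType) (X : topologicalType) : \bar R :=
  if [set: X] == set0 then (-1)%:E else
  ereal_sup [set n%:R%:E | n in [set n : nat |
    exists x : 'I_n.+1 -> X,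
      forall i j : 'I_n.+1, (i < j)%N ->
        closure [set x i] `<` closure [set x j]]].

Definition finite_dimensional (R : realType) (X : topologicalType) : Prop :=
  krull_dim R X \is a fin_num.

Definition finite_height (R : realType) (X : topologicalType) : Prop :=
  height R X \is a fin_num.

Section KolmogorovQuotient.
Variable X : topologicalType.

Definition specialization (x y : X) : Prop := closure [set y] x.

Definition kolmogorov_equiv (x y : X) : bool :=
  `[< specialization x y /\ specialization y x >].

Lemma specialization_refl (x : X) : specialization x x.
Proof. exact: subset_closure. Qed.

Lemma specialization_trans (x y z : X) :
  specialization x y -> specialization y z -> specialization x z.
Proof.
move=> xy yz; apply: closed_closure.
have yz' : [set y] `<=` closure [set z] by move=> _ ->.
exact: (closureS yz') xy.
Qed.

Lemma kolmogorov_equiv_refl : reflexive kolmogorov_equiv.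
Proof. by move=> x; apply/asboolP; split; exact: specialization_refl. Qed.

Lemma kolmogorov_equiv_sym : symmetric kolmogorov_equiv.
Proof. by move=> x y; apply/asboolP/asboolP => -[]. Qed.

Lemma kolmogorov_equiv_trans : transitive kolmogorov_equiv.
Proof.
move=> y x z /asboolP[xy yx] /asboolP[yz zy]; apply/asboolP; split.
- exact: specialization_trans xy yz.
- exact: specialization_trans zy yx.
Qed.

Canonical kolmogorov_equiv_rel :=
  EquivRel kolmogorov_equiv
    kolmogorov_equiv_refl kolmogorov_equiv_sym kolmogorov_equiv_trans.

Definition kolmogorov_quotient : topologicalType :=
  quotient_topology {eq_quot kolmogorov_equiv}.

End KolmogorovQuotient.

(* Main.v *)
(** In an Alexandrov space the closed sets are the down-sets of the
    specialization preorder, and a closed irreducible set is an up-directed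
    one.  Closures of points are irreducible, so the height is at most the
    Krull dimension.  When the height is finite, strictly increasing chains of
    point closures stop, so a closed irreducible set, being directed, has a
    greatest element, i.e. is a point closure, and both suprema range over the
    same chains.  The Kolmogorov projection preserves and reflects the
    specialization preorder, hence preserves the height. *)

Require Import Defs.
From mathcomp Require Import all_boot all_order all_algebra.
From mathcomp Require Import all_classical all_reals.
From mathcomp Require Import ereal topology.

Set Implicit Arguments.
Unset Strict Implicit.
Unset Printing Implicit Defensive.

Import Order.TTheory GRing.Theory Num.Theory.

Local Open Scope classical_set_scope.
Local Open Scope ring_scope.
Local Open Scope quotient_scope.

Section Specialization.
Variable X : topologicalType.
Implicit Types (x y : X) (A B C : set X).

Lemma closure1_sub x A : closed A -> A x -> closure [set x] `<=` A.
Proof.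
move=> cA Ax.
by rewrite [X in _ `<=` X](closure_id A).1 //; apply: closureS => _ ->.
Qed.

Lemma specialization_closureS x y :
  specialization x y <-> closure [set x] `<=` closure [set y].
Proof.
split=> [xy|]; last by apply; exact: specialization_refl.
by apply: closure1_sub => //; exact: closed_closure.
Qed.

(** Moves irreducibility from the subspace to closed sets of [X]: preimages under the continuous
    [set_val] are closed and cover the subspace. *)
Lemma irreducible_closed_cover A B C : irreducible_set A ->
  closed B -> closed C -> A `<=` B `|` C -> A `<=` B \/ A `<=` C.
Proof.
move=> irrA cB cC ABC.
have cval D : closed D -> closed (@set_val _ A @^-1` D).
  by move=> cD; apply: closed_comp => // x _; exact: initial_continuous.
have sub D : [set: set_type A] = set_val @^-1` D -> A `<=` D.
  move=> TD x Ax; have : [set: set_type A] (SigSub (mem_set Ax)) by [].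
  by rewrite TD.
have [||] := irrA _ _ (cval _ cB) (cval _ cC).
- by apply/seteqP; split=> // -[x Ax] _; exact: ABC (set_mem Ax).
- by move/sub; left.
- by move/sub; right.
Qed.

(** The point [x] is generic: a closed subset of the subspace that contains it is everything, and
    one of [B], [C] contains it. *)
Lemma irreducible_closure1 x : irreducible_set (closure [set x]).
Proof.
set A := closure [set x] => B C cB cC TBC.
have Ax : A x := @specialization_refl X x.
pose x' : set_type A := SigSub (mem_set Ax).
have generic (D : set (set_type A)) : closed D -> D x' -> [set: set_type A] = D.
  move=> cD Dx; apply/seteqP; split=> // y _; apply: cD => U.
  rewrite nbhsE => -[V [[W oW <-] Wy] VU].
  (* As [y] lies in the closure of [x], its neighbourhood [W] meets [[set x]], so [W] contains
     [x]. *)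
  have [z [-> Wx]] := set_mem (valP y) W (open_nbhs_nbhs (conj oW Wy)).
  by exists x'; split=> //; apply: VU.
have : [set: set_type A] x' by [].
by rewrite {1}TBC => -[Dx|Dx]; [left|right]; exact: generic.
Qed.

Hypothesis hX : alexandrov X.

Lemma alexandrov_closed_down A :
  (forall x y, A y -> specialization x y -> A x) -> closed A.
Proof.
move=> downA.
have -> : A = \bigcup_(B in [set closure [set y] | y in A]) B.
  apply/seteqP; split=> [x Ax|x [_ [y Ay <-]]]; last exact: downA.
  by exists (closure [set x]); [exists x|exact: specialization_refl].
by apply: hX => _ [y _ <-]; exact: closed_closure.
Qed.

(** Without a common upper bound in [A], the points not above [x] and those not above [y] would
    cover [A]. Both sets are down-sets, hence closed, so one contains [A], although [x] is above [x]
    and [y] above [y]. *)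
Lemma irreducible_directed A x y : irreducible_set A -> A x -> A y ->
  exists z, [/\ A z, specialization x z & specialization y z].
Proof.
move=> irrA Ax Ay; apply: contrapT => noz.
have cl_not_above w : closed [set z : X | ~ specialization w z].
  apply: alexandrov_closed_down => u v nwv uv wu; apply: nwv.
  exact: specialization_trans wu uv.
have [|/(_ x Ax)|/(_ y Ay)] :=
    irreducible_closed_cover irrA (cl_not_above x) (cl_not_above y).
- move=> z Az; apply: contrapT => /not_orP[/contrapT xz /contrapT yz].
  by apply: noz; exists z.
- by apply; exact: specialization_refl.
- by apply; exact: specialization_refl.
Qed.

(** If [A] has no greatest point, directedness puts a strictly larger point of [A] above each of its
    points; iterating exceeds the bound [N]. *)
Lemma irreducible_generic_point (N : nat) A :
  (forall n (x : 'I_n.+1 -> X),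
    (forall i j : 'I_n.+1, (i < j)%N ->
      closure [set x i] `<` closure [set x j]) -> (n <= N)%N) ->
  closed A -> irreducible_set A -> A !=set0 ->
  exists x, A = closure [set x].
Proof.
move=> chainN cA irrA [a Aa]; apply: contrapT => nogen.
(* The premise [A x] sits under the existential so that [choice] gives a total function; outside [A]
   its value is irrelevant. *)
have step x : exists z, A x -> A z /\ closure [set x] `<` closure [set z].
  have [Ax|nAx] := pselect (A x); last by exists x.
  have [y [Ay nxy]] : exists y, A y /\ ~ specialization y x.
    apply: contrapT => noy; apply: nogen; exists x; apply/seteqP.
    split; last exact: closure1_sub.
    by move=> y Ay; apply: contrapT => nyx; apply: noy; exists y.
  have [z [Az xz yz]] := irreducible_directed irrA Ax Ay.
  exists z => _; split=> //; split; first exact/specialization_closureS.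
  by move=> /(_ y yz).
have [f fP] := choice step.
pose u n := iter n f a.
have Au n : A (u n) by elim: n => // n IH; exact: (fP _ IH).1.
have u_lt i j : (i < j)%N -> closure [set u i] `<` closure [set u j].
  elim: j => // j IH; rewrite ltnS leq_eqVlt => /orP[/eqP ->|/IH uij].
    exact: (fP _ (Au j)).2.
  have [le_f nle_f] := (fP _ (Au j)).2.
  split; first exact: subset_trans (properW uij) le_f.
  by move=> /subset_trans-/(_ _ (properW uij)).
(* The N+2 points [u 0], ..., [u N.+1] form a chain of length N+1. *)
have := chainN N.+1 (fun i => u i) (fun i j => @u_lt i j).
by rewrite ltnn.
Qed.

End Specialization.

Section Dimension.
Variables (R : realType) (X : topologicalType).

Lemma height_le_krull_dim : (height R X <= krull_dim R X)%E.
Proof.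
rewrite /height /krull_dim; case: ifP => // _.
apply: ereal_sup_le => _ [n [x xP] <-].
exists n => //.
exists (fun i => closure [set x i]); split=> // i; split.
- exact: closed_closure.
- exact: irreducible_closure1.
- by exists (x i); exact: specialization_refl.
Qed.

(** Excludes the value -oo, so that finiteness only requires being below +oo. A single point is a
    chain of length 0. *)
Lemma height_geN1 : ((-1)%:E <= height R X)%E.
Proof.
rewrite /height; case: ifPn => // /set0P[x _].
apply: le_ereal_sup_tmp; exists 0%:R%:E; last by rewrite lee_fin lerN10.
exists 0 => //; exists (fun=> x) => i j.
by rewrite (ord1 i) (ord1 j).
Qed.

(** Supplies the natural number [N] that [irreducible_generic_point] asks for. *)
Lemma finite_height_bound (n : nat) (x : 'I_n.+1 -> X) :
  finite_height R X ->
  (forall i j : 'I_n.+1, (i < j)%N ->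
    closure [set x i] `<` closure [set x j]) ->
  (n <= Num.truncn (fine (height R X)))%N.
Proof.
move=> finX xP.
have le_n : (n%:R%:E <= height R X)%E.
  rewrite /height ifN; last by apply/set0P; exists (x ord0).
  by apply: ereal_sup_ubound; exists n => //; exists x.
rewrite truncn_ge_nat; last by rewrite (le_trans (ler0n R n))// -lee_fin fineK.
by rewrite -lee_fin fineK.
Qed.

Lemma finite_dimensional_height : finite_dimensional R X -> finite_height R X.
Proof.
rewrite /finite_dimensional /finite_height => finX.
rewrite fin_real // (lt_le_trans (ltNyr (-1)) height_geN1) /=.
by rewrite (le_lt_trans height_le_krull_dim) // ltey_eq finX.
Qed.

Lemma krull_dim_height : alexandrov X -> finite_height R X ->
  krull_dim R X = height R X.
Proof.
move=> hX finX; apply/le_anti; rewrite height_le_krull_dim andbT.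
rewrite /height /krull_dim; case: ifP => // _.
apply: ereal_sup_le => _ [n [C [CP C_lt]] <-].
exists n => //.
have gen i : exists x, C i = closure [set x].
  have [cC irrC C0] := CP i.
  by apply: irreducible_generic_point C0 => // m x; exact: finite_height_bound.
have [x xP] := choice gen.
by exists x => i j ij; rewrite -!xP; exact: C_lt.
Qed.

End Dimension.

Section Quotient.
Variable X : topologicalType.
Let Q := kolmogorov_quotient X.
Let p (x : X) : Q := \pi_Q x.

Lemma pi_kolmogorov_eq (x y : X) :
  p x = p y -> specialization x y /\ specialization y x.
Proof.
by move=> /(@eqmodP _ (kolmogorov_equiv_rel X)) /asboolP.
Qed.

Lemma pi_kolmogorov_surj (q : Q) : exists x, q = p x.
Proof. by exists (repr q); rewrite /p reprK. Qed.

Lemma closed_kolmogorov (A : set Q) : closed A <-> closed (p @^-1` A).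
Proof.
split=> cA; first by apply: closed_comp cA => x _; exact: pi_continuous.
by rewrite -openC /open /= /quotient_open preimage_setC openC.
Qed.

Lemma alexandrov_kolmogorov : alexandrov X -> alexandrov Q.
Proof.
move=> hX F cF; apply/closed_kolmogorov; rewrite preimage_bigcup.
(* Reindexes the union by the family of preimages, the form [alexandrov] expects. *)
rewrite -(bigcup_image F (fun A => p @^-1` A) id).
by apply: hX => _ [A FA <-]; exact: (closed_kolmogorov A).1 (cF _ FA).
Qed.

Lemma specialization_kolmogorov (x y : X) :
  specialization (p x) (p y) <-> specialization x y.
Proof.
split=> [|xy].
  have cl : closed (p @` closure [set y]).
    apply/closed_kolmogorov.
    (* The closure of [y] is saturated for the equivalence, so its image is closed in [Q]; it
       contains [p y], hence the whole closure of [p y]. *)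
    have -> : p @^-1` (p @` closure [set y]) = closure [set y].
      apply/seteqP; split=> [z [w wy /pi_kolmogorov_eq[_ zw]]|z zy].
        exact: specialization_trans zw wy.
      by exists z.
    exact: closed_closure.
  have py : (p @` closure [set y]) (p y).
    by exists y => //; exact: specialization_refl.
  move=> /(closure1_sub cl py)[w wy /pi_kolmogorov_eq[_ xw]].
  exact: specialization_trans xw wy.
have : closed (p @^-1` closure [set p y]).
  exact: (closed_kolmogorov _).1 (@closed_closure _ _).
by move/closure1_sub => /(_ y (@specialization_refl Q (p y))); exact.
Qed.

Lemma closure_proper_kolmogorov (x y : X) :
  closure [set p x] `<` closure [set p y] <->
  closure [set x] `<` closure [set y].
Proof.
have E u v : closure [set p u] `<=` closure [set p v] <->
             closure [set u] `<=` closure [set v].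
  by rewrite -!specialization_closureS specialization_kolmogorov.
by split=> -[/E xy /E yx].
Qed.

Lemma height_kolmogorov (R : realType) : height R Q = height R X.
Proof.
rewrite /height.
have -> : ([set: Q] == set0) = ([set: X] == set0).
  apply/eqP/eqP => E; apply/seteqP; split=> // x _.
    by have : [set: Q] (p x) by []; rewrite E.
  by have [y _] := pi_kolmogorov_surj x; have : [set: X] y by []; rewrite E.
case: ifP => // _; congr (ereal_sup (_ @` _)).
apply/seteqP; split=> n [x xP].
  (* A chain in [Q] is lifted by choosing representatives of its points. *)
  have [y yP] := choice (fun i => pi_kolmogorov_surj (x i)).
  by exists y => i j ij; apply/closure_proper_kolmogorov; rewrite -!yP; exact: xP.
by exists (p \o x) => i j ij; apply/closure_proper_kolmogorov; exact: xP.
Qed.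

End Quotient.

Theorem theorem1 (R : realType) (X : topologicalType) (hX : alexandrov X) :
  (finite_dimensional R X <-> finite_height R X) /\
  (finite_dimensional R X ->
    [/\ krull_dim R X = height R X,
        height R X = height R (kolmogorov_quotient X)
      & krull_dim R X = krull_dim R (kolmogorov_quotient X)]).
Proof.
split.
  split=> [|finX]; first exact: finite_dimensional_height.
  by rewrite /finite_dimensional krull_dim_height.
move=> /finite_dimensional_height finX.
have finQ : finite_height R (kolmogorov_quotient X).
  by rewrite /finite_height height_kolmogorov.
rewrite !krull_dim_height ?height_kolmogorov //.
exact: alexandrov_kolmogorov.
Qed.
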